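(* Let $\mathcal{D}_{\mathbb{P}}=(\mathcal{D},\mathbb{P})$ be an uncertain Markov chain with parameter space $\mathcal{V}_{\mathcal{D}}$, and let $\varphi_r=\mathbb{P}_{\le\lambda}(\lozenge T)$ be a reachability specification. Let $\mathcal{U}\subseteq\mathcal{V}_{\mathcal{D}}$ be a set of $K=|\mathcal{U}|\ge 2$ parameter instantiations sampled independently according to $\mathbb{P}$, and let $\mathcal{Q}\subseteq\mathcal{U}$ be the set of those samples $u$ for which $\mathcal{D}[u]$ violates $\varphi_r$, with $L=|\mathcal{Q}|$. For a given tolerance probability $\nu\in[0,1)$, let the associated confidence probability be $$\alpha_\nu=\binom{L+1}{L}\sum_{i=0}^{L+1}\binom{K}{i}(1-\nu)^{K-i}\nu^i.$$ Then, with probability at least $1-\alpha_\nu$ (with respect to the random drawing of the samples), we have $F(\mathcal{D}_{\mathbb{P}},\varphi_r)\ge 1-\nu$.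
   Context: A parametric Markov chain (pMC) is $\mathcal{D}=(S,s_I,V,\mathcal{P})$ with finite state set $S$, initial state $s_I$, finite set $V$ of real-valued parameters, and transition function $\mathcal{P}:S\times S\to\mathbb{Q}[V]$. For an instantiation $u$, $\mathcal{D}[u]$ replaces each polynomial $f$ by $f[u]$. The parameter space $\mathcal{V}_{\mathcal{D}}$ consists of instantiations yielding well-defined, graph-preserving Markov chains. An uncertain Markov chain is $(\mathcal{D},\mathbb{P})$ with $\mathbb{P}$ a probability distribution over $\mathcal{V}_{\mathcal{D}}$. A Markov chain satisfies $\varphi_r=\mathbb{P}_{\le\lambda}(\lozenge T)$ ($T\subseteq S$, $\lambda\in[0,1]$) iff the probability of reaching $T$ from the initial state is at most $\lambda$. The satisfaction probability is $F(\mathcal{D}_{\mathbb{P}},\varphi)=\int_{\mathcal{V}_{\mathcal{D}}} I_\varphi(u)\,d\mathbb{P}(u)$ with $I_\varphi(u)=1$ iff $\mathcal{D}[u]\models\varphi$, else $0$. *)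

(* Defs.v *)
From HB Require Import structures.
From mathcomp Require Import all_boot all_order all_algebra.
From mathcomp Require Import all_classical all_reals all_analysis.
(* The notations clash with those of MathComp-Analysis. *)
From mathcomp Require Import -(notations) mpoly.

Set Implicit Arguments.
Unset Strict Implicit.
Unset Printing Implicit Defensive.

Import Order.TTheory GRing.Theory Num.Theory.
Import numFieldNormedType.Exports.

Local Open Scope classical_set_scope.
Local Open Scope ring_scope.

(* The parameters are indexed by 'I_(nparams). *)
Record pMC := PMC {
  state : finType;
  init : state;
  nparams : nat;
  trans : state -> state -> mpoly nparams rat }.

(* Tuples over R carry the product Borel sigma-algebra, which is why they are
   used for instantiations rather than functions 'I_n -> R. *)
Definition instantiation (R : realType) (D : pMC) := (nparams D).-tuple R.

(* D[u]: the coefficients are embedded in R, then the polynomial is evaluated. *)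
Definition inst_trans (R : realType) (D : pMC) (u : instantiation R D)
    (s t : state D) : R :=
  meval (tnth u) (map_mpoly (@ratr R) (trans s t)).

Definition well_defined (R : realType) (D : pMC) (u : instantiation R D) :=
  (forall s t : state D, 0 <= inst_trans u s t) /\
  (forall s : state D, \sum_(t : state D) inst_trans u s t = 1).

(* No transition that is present in the pMC vanishes under u. *)
Definition graph_preserving (R : realType) (D : pMC) (u : instantiation R D) :=
  forall s t : state D, trans s t != 0 -> 0 < inst_trans u s t.

Definition parameter_space (R : realType) (D : pMC) : set (instantiation R D) :=
  [set u | well_defined u /\ graph_preserving u].
Arguments parameter_space R D : clear implicits.

(* The path w_0 ... w_k starts in s0 and visits T at time k and not before. *)
Definition first_hit (S : finType) (s0 : S) (T : {set S}) (k : nat)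
    (w : {ffun 'I_k.+1 -> S}) : bool :=
  [&& w ord0 == s0, w ord_max \in T &
      [forall i : 'I_k.+1, (i < k)%N ==> (w i \notin T)]].

(* Probability of eventually reaching T from s0: the event is the disjoint union
   of the cylinders of the finite paths that first hit T in their last state,
   and the cylinder of w_0 ... w_k has probability \prod_(i < k) P w_i w_(i+1). *)
Definition reach_prob (R : realType) (S : finType) (P : S -> S -> R) (s0 : S)
    (T : {set S}) : \bar R :=
  (\sum_(0 <= k <oo)
     (\sum_(w : {ffun 'I_k.+1 -> S} | first_hit s0 T w)
        \prod_(i < k) P (w (widen_ord (leqnSn k) i)) (w (lift ord0 i)))%:E)%E.

(* D[u] |= P_{<= lambda} (eventually T) *)
Definition satisfies (R : realType) (D : pMC) (lambda : R)
    (T : {set state D}) (u : instantiation R D) : Prop :=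
  (reach_prob (inst_trans u) (init D) T <= lambda%:E)%E.

Definition satisfaction_prob (R : realType) (D : pMC)
    (P : probability (instantiation R D) R) (lambda : R)
    (T : {set state D}) : \bar R :=
  (\int[P]_(u in parameter_space R D)
     (\1_[set v : instantiation R D | satisfies lambda T v] u)%:E)%E.

Definition mutually_independent (R : realType) d d' (Omega : measurableType d)
    (E : measurableType d') (Pr : probability Omega R) (I : finType)
    (X : I -> {mfun Omega >-> E}) : Prop :=
  forall (J : {set I}) (A : I -> set E), (forall i, measurable (A i)) ->
    Pr (\bigcap_(i in [set` J]) X i @^-1` A i) =
    (\prod_(i in J) Pr (X i @^-1` A i))%E.

Definition has_law (R : realType) d d' (Omega : measurableType d)
    (E : measurableType d') (Pr : probability Omega R) (P : probability E R)
    (X : {mfun Omega >-> E}) : Prop :=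
  forall A : set E, measurable A -> Pr (X @^-1` A) = P A.

(* Samples are counted by their index in the drawing, so that repeated values
   (possible when the law has atoms) count with multiplicity. *)
Definition violating (R : realType) (D : pMC) (lambda : R) (T : {set state D})
    (K : nat) (U : 'I_K -> instantiation R D) : {set 'I_K} :=
  [set i | `[< ~ satisfies lambda T (U i) >]]%SET.

Definition alpha (R : realType) (K L : nat) (nu : R) : R :=
  'C(L.+1, L)%:R *
  \sum_(0 <= i < L.+2) 'C(K, i)%:R * (1 - nu) ^+ (K - i) * nu ^+ i.

(* Main.v *)
(* Let q = 1 - F be the probability that one sample violates the specification.
   If q <= nu there is nothing to prove. Otherwise the number L of violating
   samples is binomial with parameters K and q; with m the largest number of
   violations whose confidence level alpha is at most beta, the event
   alpha <= beta is contained in L <= m, and since the binomial distribution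
   function decreases in its success probability,
     Pr (L <= m) <= Pr (Bin(K, nu) <= m) <= Pr (Bin(K, nu) <= m + 1) <= alpha.
   Measurability is only available on the parameter space, where the series
   defining the reachability probability has nonnegative terms. *)

Require Import Defs.
From HB Require Import structures.
From mathcomp Require Import all_boot all_order all_algebra.
From mathcomp Require Import all_classical all_reals all_analysis.
From mathcomp Require Import measurable_realfun ring.
From mathcomp Require Import -(notations) mpoly.

Set Implicit Arguments.
Unset Strict Implicit.
Unset Printing Implicit Defensive.

Import Order.TTheory GRing.Theory Num.Theory.
Import numFieldNormedType.Exports.

Local Open Scope classical_set_scope.
Local Open Scope ring_scope.

(* Strict: the probability that Bin(K, p) < m, not <= m. *)
Definition binom_cdf (R : realType) (K m : nat) (p : R) : R :=
  \sum_(0 <= i < m) 'C(K, i)%:R * (1 - p) ^+ (K - i) * p ^+ i.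

Lemma binom_cdf0 (R : realType) (m : nat) (p : R) :
  binom_cdf 0 m.+1 p = 1.
Proof.
rewrite /binom_cdf big_nat_recl// bin0 subnn !expr0 !mulr1 big1 ?addr0// => i _.
by rewrite bin0n !mul0r.
Qed.

(** Condition on one of the [K.+1] trials: a failure leaves the bound on the successes unchanged, a
    success lowers it by one. Algebraically this is Pascal's rule. *)
Lemma binom_cdfSS (R : realType) (K m : nat) (p : R) :
  binom_cdf K.+1 m.+1 p = (1 - p) * binom_cdf K m.+1 p + p * binom_cdf K m p.
Proof.
rewrite /binom_cdf [LHS]big_nat_recl// [in RHS]big_nat_recl// mulrDr -addrA.
congr +%R; first by rewrite !bin0 !subn0 !expr0 !mulr1 !mul1r exprS.
rewrite !mulr_sumr -big_split/=; apply: eq_bigr => i _.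
rewrite binS natrD subSS exprS.
(* For [K <= i] both truncated exponents are 0, so the factor [1 - p] has no power to join; the
   coefficient ['C(K, i.+1)] vanishes instead. *)
have [iK|Ki] := ltnP i K; last by rewrite [in 'C(K, i.+1)]bin_small//; ring.
by rewrite -[(K - i)%N]prednK ?subn_gt0// -subnS exprS; ring.
Qed.

Lemma binom_cdf_le_nat (R : realType) (K m : nat) (p : R) :
  0 <= p <= 1 -> binom_cdf K m p <= binom_cdf K m.+1 p.
Proof.
move=> /andP[p0 p1]; rewrite /binom_cdf big_nat_recr//= lerDl.
by rewrite !mulr_ge0// exprn_ge0// subr_ge0.
Qed.

(** Induction on [K], splitting off one trial: the parameter is changed first in the remaining [K]
    trials, then in the split one. *)
Lemma binom_cdf_anti (R : realType) (K m : nat) (p q : R) :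
  0 <= p -> p <= q -> q <= 1 -> binom_cdf K m q <= binom_cdf K m p.
Proof.
move=> p0 pq q1; elim: K m => [|K IH] [|m]; rewrite ?binom_cdf0//.
- by rewrite /binom_cdf !big_geq.
- by rewrite /binom_cdf !big_geq.
(* With the values fixed, moving weight from m.+1 to m decreases the average. *)
rewrite !binom_cdfSS.
apply: (@le_trans _ _ ((1 - q) * binom_cdf K m.+1 p + q * binom_cdf K m p)).
  by rewrite lerD// ler_wpM2l// ?subr_ge0// (le_trans p0).
have := @binom_cdf_le_nat R K m p; rewrite p0 (le_trans pq q1) => /(_ isT).
rewrite -subr_ge0 => h; rewrite -subr_ge0.
have -> : (1 - p) * binom_cdf K m.+1 p + p * binom_cdf K m p -
  ((1 - q) * binom_cdf K m.+1 p + q * binom_cdf K m p) =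
  (q - p) * (binom_cdf K m.+1 p - binom_cdf K m p) by ring.
by rewrite mulr_ge0// subr_ge0.
Qed.

Lemma sum_subsets_binom (R : realType) (I : finType) (m : nat) (q : R) :
  \sum_(J : {set I} | (#|J| < m)%N) q ^+ #|J| * (1 - q) ^+ (#|I| - #|J|) =
  binom_cdf #|I| m q.
Proof.
rewrite /binom_cdf big_mkord.
transitivity (\sum_(i < m) \sum_(J : {set I} | #|J| == i)
    q ^+ #|J| * (1 - q) ^+ (#|I| - #|J|)).
  rewrite (exchange_big_dep (fun J : {set I} => (#|J| < m)%N))/=; last first.
    by move=> i J _ /eqP ->.
  by apply: eq_bigr => J Jm; rewrite (big_pred1 (Ordinal Jm)).
apply: eq_bigr => i _; under eq_bigr => J /eqP -> do [].
rewrite sumr_const -cardsE card_draws -[LHS]mulr_natl -mulrA.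
by rewrite [_ ^+ i * _]mulrC.
Qed.

Section hitting_indices.
Context (R : realType) d d' (Omega : measurableType d) (E : measurableType d')
  (I : finType) (X : I -> {mfun Omega >-> E}) (V : set E) (mV : measurable V).

Definition hits (w : Omega) : {set I} := [set i | `[< V (X i w) >]]%SET.

Let piece (J : {set I}) (i : I) : set E := if i \in J then V else ~` V.

Let mpiece J i : measurable (piece J i).
Proof. by rewrite /piece; case: ifP => // _; exact: measurableC. Qed.

(** Indexing by the full finite set gives the event the exact shape that [mutually_independent]
    factorizes. *)
Lemma hits_eqE (J : {set I}) :
  [set w | hits w = J] = \bigcap_(i in [set` [set: I]%SET]) X i @^-1` piece J i.
Proof.
apply/seteqP; split=> w /=.
  by move=> <- i _ /=; rewrite /piece inE; case: asboolP.
move=> H; apply/setP => i; rewrite inE.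
have {H}:= H i; rewrite /= inE /piece => /(_ isT).
by case: (i \in J) => h; apply/asboolP.
Qed.

Lemma measurable_hits_eq (J : {set I}) : measurable [set w | hits w = J].
Proof.
rewrite hits_eqE; apply: fin_bigcap_measurable => // i _.
rewrite -[_ @^-1` _]setTI; exact: measurable_funPT.
Qed.

Lemma card_hitsE (A : pred nat) :
  [set w | A #|hits w|] =
  \bigcup_(J in [set J : {set I} | A #|J|]) [set w | hits w = J].
Proof.
by apply/seteqP; split=> [w Aw|w [J /= AJ e]]; [exists (hits w)|rewrite /= e].
Qed.

Lemma measurable_card_hits (A : pred nat) : measurable [set w | A #|hits w|].
Proof.
rewrite card_hitsE; apply: fin_bigcup_measurable => // J _.
exact: measurable_hits_eq.
Qed.

(** The exact hit patterns are disjoint, and by independence a pattern [J] has a probability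
    depending only on its cardinality. [A] is arbitrary so that it can be a condition on the
    confidence level. *)
Lemma prob_card_hits (Pr : probability Omega R) (q : R) (A : pred nat) :
  mutually_independent Pr X -> (forall i, Pr (X i @^-1` V) = q%:E) ->
  Pr [set w | A #|hits w|] =
  (\sum_(J : {set I} | A #|J|) q ^+ #|J| * (1 - q) ^+ (#|I| - #|J|))%:E.
Proof.
move=> indep PrV; rewrite card_hitsE measure_fin_bigcup; first last.
- by move=> J _; exact: measurable_hits_eq.
- by move=> J1 J2 _ _ [w [/= <- <-]].
- exact: finite_finset.
rewrite (fsbig_fwiden (enum [pred J : {set I} | A #|J|])) ?enum_uniq//;
  first last.
- by move=> J [/=]; rewrite mem_enum inE.
- by move=> J /= AJ; rewrite mem_enum inE.
rewrite big_enum -sumEFin/=; apply: eq_bigr => J _.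
rewrite hits_eqE indep//.
rewrite (eq_bigr (fun i => (if i \in J then q else 1 - q)%:E)); last first.
  move=> i _; rewrite /piece; case: ifP => // _.
  rewrite preimage_setC probability_setC ?PrV//.
  by rewrite -[Y in measurable Y]setTI; exact: measurable_funPT.
rewrite prodEFin; congr EFin.
rewrite (eq_bigl xpredT) => [|i]; last by rewrite inE.
rewrite (bigID (mem J))/=; congr (_ * _).
  by rewrite (eq_bigr (fun=> q)) ?prodr_const// => i ->.
rewrite (eq_bigr (fun=> 1 - q)) => [|i /negbTE -> //].
by rewrite prodr_const -(cardC (mem J)) addKn.
Qed.

End hitting_indices.

Lemma measurable_inst_trans (R : realType) (D : pMC) (s t : state D) :
  measurable_fun [set: instantiation R D] (fun u => inst_trans u s t).
Proof.
rewrite /inst_trans; under eq_fun do rewrite mevalE.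
apply: measurable_sum => m; apply: measurable_funM => //.
apply: measurable_prod => i _; apply: measurable_funX; exact: measurable_tnth.
Qed.

Lemma measurable_parameter_space (R : realType) (D : pMC) :
  measurable (parameter_space R D).
Proof.
have mI := @measurable_inst_trans R D.
have -> : parameter_space R D =
    (\bigcap_(st in [set: state D * state D])
       [set u | 0 <= inst_trans u st.1 st.2]) `&`
    (\bigcap_(s in [set: state D])
       (fun u => \sum_t inst_trans u s t) @^-1` [set 1]) `&`
    (\bigcap_(st in [set st : state D * state D | trans st.1 st.2 != 0])
       [set u | 0 < inst_trans u st.1 st.2]).
  apply/seteqP; split=> u /=.
    move=> [[h1 h2] h3]; split; [split|].
    - by move=> st _; exact: h1.
    - by move=> s _; exact: h2.
    - by move=> st; exact: h3.
  move=> [[h1 h2] h3]; split; [split|].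
  - by move=> s t; exact: (h1 (s, t)).
  - by move=> s; exact: (h2 s).
  - by move=> s t; exact: (h3 (s, t)).
have mpred (f g : instantiation R D -> R) (r : R -> R -> bool) :
    measurable_fun setT (fun u => r (f u) (g u)) ->
    measurable [set u | r (f u) (g u)].
  move=> mr; rewrite -[X in measurable X]setTI.
  exact: (mr measurableT [set true]).
apply: measurableI; [apply: measurableI|]; apply: fin_bigcap_measurable;
  try exact: finite_finset.
- by move=> st _; exact: (mpred _ _ <=%R (measurable_fun_ler _ _)).
- move=> s _; rewrite -[X in measurable X]setTI.
  exact: (measurable_sum _ (fun t => mI s t)).
- by move=> st _; exact: (mpred _ _ <%R (measurable_fun_ltr _ _)).
Qed.

Lemma measurable_satisfies (R : realType) (D : pMC) (lambda : R)
    (T : {set state D}) :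
  measurable (parameter_space R D `&` [set u | satisfies lambda T u]).
Proof.
apply: emeasurable_fun_infty_c; first exact: measurable_parameter_space.
rewrite /reach_prob.
apply: ge0_emeasurable_sum => [k u [[ge0 _] _] _|k _].
  rewrite lee_fin; apply: sumr_ge0 => w _.
  by apply: prodr_ge0 => i _; exact: ge0.
apply/measurable_EFinP/measurable_funTS.
under eq_fun do rewrite -big_filter.
apply: measurable_sum => w.
by apply: measurable_prod => i _; exact: measurable_inst_trans.
Qed.

Lemma satisfaction_probE (R : realType) (D : pMC)
    (P : probability (instantiation R D) R) (lambda : R) (T : {set state D}) :
  satisfaction_prob P lambda T =
  P (parameter_space R D `&` [set u | satisfies lambda T u]).
Proof.
have mPS := @measurable_parameter_space R D.
have mS := measurable_satisfies lambda T.
set S := _ `&` _ in mS *.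
(* [satisfies] is known to be measurable only inside the parameter space, so the integral is
   computed with the indicator of [S], which agrees with the integrand there. *)
rewrite -[in RHS](_ : S `&` parameter_space R D = S); last first.
  by rewrite setIAC setIid.
rewrite -integral_indic//.
apply: eq_integral => u uPS; congr EFin; rewrite !indicE; congr (_%:R).
by rewrite in_setI uPS.
Qed.

Lemma sum_subsets_alpha_le (R : realType) (I : finType) (nu q beta : R) :
  0 <= nu -> nu <= q -> q <= 1 -> 0 <= beta ->
  \sum_(J : {set I} | alpha #|I| #|J| nu <= beta)
    q ^+ #|J| * (1 - q) ^+ (#|I| - #|J|) <= beta.
Proof.
move=> nu0 nuq q1 beta0.
pose A (J : {set I}) := alpha #|I| #|J| nu <= beta.
(* If no cardinality reaches the level [beta], the sum is empty. *)
have [J0 AJ0|A0] := pickP A; last first.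
  by rewrite big_pred0.
have [J AJ Jmax] := @arg_maxnP _ J0 A (fun J : {set I} => #|J|) AJ0.
have nu1 : 0 <= nu <= 1 by rewrite nu0 (le_trans nuq).
(* Every admissible set has at most [#|J|] elements, so the sum is bounded by the tail below
   [#|J|.+1]. *)
apply: le_trans (AJ); apply: (@le_trans _ _ (binom_cdf #|I| #|J|.+1 q)).
  rewrite -sum_subsets_binom big_mkcond [leRHS]big_mkcond/=.
  apply: ler_sum => B _; case: ifPn => [/Jmax BJ|_]; first by rewrite ltnS ifT.
  by case: ifP => // _; rewrite mulr_ge0// exprn_ge0 ?subr_ge0// (le_trans nu0).
apply: (le_trans (binom_cdf_anti _ _ nu0 nuq q1)).
apply: (le_trans (binom_cdf_le_nat _ _ nu1)).
(* The prefactor ['C(L.+1, L)] equals [L.+1], hence is at least 1. *)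
rewrite /alpha binSn ler_peMl// ?ler1n//.
rewrite sumr_ge0// => i _; rewrite !mulr_ge0// exprn_ge0// subr_ge0.
by case/andP: nu1.
Qed.

(** The confidence level is itself random, through the number of violations. It is therefore
    compared with an arbitrary fixed [beta]: the bad event, a level of at most [beta] although the
    bound on the satisfaction probability fails, has probability at most [beta]. *)
Theorem theorem2 (R : realType) (D : pMC)
    (P : probability (instantiation R D) R)
    (P_supp : P (parameter_space R D) = 1%E)
    (lambda : R) (lambda01 : 0 <= lambda <= 1) (T : {set state D})
    (K : nat) (K_ge2 : (2 <= K)%N)
    (d : measure_display) (Omega : measurableType d) (Pr : probability Omega R)
    (U : 'I_K -> {mfun Omega >-> instantiation R D})
    (U_in : forall (i : 'I_K) (w : Omega), parameter_space R D (U i w))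
    (U_law : forall i : 'I_K, has_law Pr P (U i))
    (U_indep : mutually_independent Pr U)
    (nu : R) (nu01 : 0 <= nu < 1)
    (beta : R) (beta_ge0 : 0 <= beta) :
  ((1 - beta)%:E <=
   Pr [set w : Omega |
        (alpha K #|violating lambda T (fun i => U i w)| nu <= beta)%R ->
        ((1 - nu)%:E <= satisfaction_prob P lambda T)%E])%E.
Proof.
case/andP: nu01 => nu0 nu1; rewrite satisfaction_probE.
set S := _ `&` _.
have mS : measurable S by exact: measurable_satisfies.
have [F_ge|F_lt] := leP (1 - nu)%:E (P S).
  rewrite [X in Pr X](_ : _ = setT) ?probability_setT ?lee_fin ?gerBl//.
  exact/seteqP.
have mV := measurableC mS.
have PS_fin : P S \is a fin_num by exact: fin_num_measure.
set q := 1 - fine (P S).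
have PV : P (~` S) = q%:E by rewrite probability_setC// EFinB fineK.
pose G := [set w | alpha K #|hits U (~` S) w| nu <= beta].
have mG : measurable G.
  exact: (measurable_card_hits U mV (fun n => alpha K n nu <= beta)).
(* Here the bound on the satisfaction probability is false, so the implication holds exactly outside
   [G]. *)
rewrite [X in Pr X](_ : _ = ~` G); last first.
  (* By [U_in] a sample can leave [S] only by violating the specification. *)
  have hitsE w : violating lambda T (fun i => U i w) = hits U (~` S) w.
    apply/setP => i; rewrite !inE; apply: asbool_equiv_eq.
    by split=> [nsat [_ /nsat]//|nS sat]; apply: nS; split.
  apply/seteqP; split=> w /=; rewrite hitsE; last by move=> nGw /nGw.
  by move=> H /H.
rewrite probability_setC// EFinB leeB//.
rewrite (prob_card_hits mV (fun n => alpha K n nu <= beta) U_indep (q := q));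
  last first.
  by move=> i; rewrite U_law.
have := @sum_subsets_alpha_le R 'I_K nu q beta.
rewrite card_ord lee_fin; apply=> //.
- by rewrite /q lerBrDr -lerBrDl -lee_fin fineK// ltW.
- by rewrite /q gerBl fine_ge0.
Qed.
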